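(* Let $a,b,n$ be positive integers such that $a\le b$, $a\equiv b \pmod 2$, and $na$ is even. Let $H_{n,a}=K_{a-1}\nabla (K_1\cup K_{n-a})$. If $G$ is a graph of order $n$ with $n\ge \max\{2a(a+1)+b-3,\ (2a+2)(a+1)\}$ and $\rho(G)\ge \rho(H_{n,a})$, then $G$ has an $(a,b)$-parity factor unless $G\cong H_{n,a}$.
   Context: All graphs are finite, simple and undirected. $\rho(G)$ denotes the spectral radius (largest eigenvalue of the adjacency matrix) of $G$. For positive integers $a\le b$ with $a\equiv b\pmod 2$, an $(a,b)$-parity factor of $G$ is a spanning subgraph $F$ of $G$ such that $d_F(v)\equiv b \pmod 2$ and $a\le d_F(v)\le b$ for every vertex $v$. $K_s$ is the complete graph on $s$ vertices ($K_0$ is the empty graph), $G_1\cup G_2$ is the vertex-disjoint union, and the join $G_1\nabla G_2$ is obtained from $G_1\cup G_2$ by adding all edges between $G_1$ and $G_2$. *)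

(* Defs.v *)
From mathcomp Require Import all_boot all_order all_algebra.
From mathcomp Require Import classical_sets reals.

Set Implicit Arguments.
Unset Strict Implicit.
Unset Printing Implicit Defensive.

Import GRing.Theory.

Local Open Scope nat_scope.

Record sgraph (T : finType) := SGraph {
  adj :> rel T;
  adj_sym : symmetric adj;
  adj_irrefl : irreflexive adj }.

Definition degree (T : finType) (G : sgraph T) (v : T) : nat :=
  #|[set u | G v u]|.

Definition isomorphic (T1 T2 : finType) (G1 : sgraph T1) (G2 : sgraph T2) :
    Prop :=
  exists2 f : T1 -> T2, bijective f & forall u v, G2 (f u) (f v) = G1 u v.

Section Constructions.

Definition complete_rel (s : nat) : rel 'I_s := fun u v => u != v.

Fact complete_sym s : symmetric (@complete_rel s).
Proof. by move=> u v; rewrite /complete_rel eq_sym. Qed.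

Fact complete_irrefl s : irreflexive (@complete_rel s).
Proof. by move=> u; rewrite /complete_rel eqxx. Qed.

Definition complete (s : nat) : sgraph 'I_s :=
  SGraph (@complete_sym s) (@complete_irrefl s).

Variables (T1 T2 : finType) (G1 : sgraph T1) (G2 : sgraph T2).

(* [across] is the adjacency between the two sides: [false] gives the disjoint
   union and [true] gives the join. *)
Definition sum_rel (across : bool) : rel (T1 + T2) := fun x y =>
  match x, y with
  | inl u, inl v => G1 u v
  | inr u, inr v => G2 u v
  | _, _ => across
  end.

Fact sum_rel_sym across : symmetric (sum_rel across).
Proof. by move=> [u|u] [v|v] //=; rewrite adj_sym. Qed.

Fact sum_rel_irrefl across : irreflexive (sum_rel across).
Proof. by move=> [u|u] /=; rewrite adj_irrefl. Qed.

Definition gunion : sgraph (T1 + T2)%type :=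
  SGraph (sum_rel_sym false) (sum_rel_irrefl false).

Definition gjoin : sgraph (T1 + T2)%type :=
  SGraph (sum_rel_sym true) (sum_rel_irrefl true).

End Constructions.

(* The subtractions are truncated; they are the intended ones when
   1 <= a <= n, in which case the graph has n vertices. *)
Definition Hgraph (n a : nat) : sgraph ('I_(a - 1) + ('I_1 + 'I_(n - a)))%type :=
  gjoin (complete (a - 1)) (gunion (complete 1) (complete (n - a))).

(* A spanning subgraph of G is a graph on the same vertex type whose edges are
   edges of G. *)
Definition parity_factor (a b : nat) (T : finType) (G F : sgraph T) : Prop :=
  subrel F G /\
  forall v, degree F v = b %[mod 2] /\ a <= degree F v <= b.

Definition has_parity_factor (a b : nat) (T : finType) (G : sgraph T) : Prop :=
  exists F : sgraph T, parity_factor a b G F.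

Local Open Scope ring_scope.

Definition adjmx (R : realType) (T : finType) (G : sgraph T) : 'M[R]_#|T| :=
  \matrix_(i, j) (G (enum_val i) (enum_val j))%:R.

(* The set of eigenvalues is finite, and nonempty when T is (the matrix is real
   symmetric), so that its supremum is the largest eigenvalue. *)
Definition spectral_radius (R : realType) (T : finType) (G : sgraph T) : R :=
  sup [set x : R | eigenvalue (adjmx R G) x]%classic.

(* Main.v *)
(** An a-regular spanning subgraph is an (a,b)-parity factor, so b plays no
    further role.

    If some vertex v has degree less than a, then G is a spanning subgraph of a
    copy of H_{n,a}.  An explicit nonnegative eigenvector of H_{n,a}, whose
    eigenvalue l >= n - 2 is the root of a cubic, shows that an eigenvalue of G
    which is at least l forces G = H_{n,a}.

    Otherwise let v be a vertex of minimum degree.  Stanley's inequality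
    rho (rho + 1) <= 2 e(G) with rho >= n - 2 shows that the complement of G has
    at most n - 1 edges, and then the degrees of any two vertices x, y different
    from v sum to at least n + 2a - 2.  Start from a star with a edges centred
    at v, and enlarge it while keeping v saturated and all degrees at most a:
    two unsaturated vertices x, y are either joined by an edge or used to
    replace an edge uw by xu and yw, which a count of the edges shows to be
    possible.  By parity, a single unsaturated vertex lacks at least two edges,
    and replacing uw by xu turns this case into the previous one. *)
Require Import Defs.
From mathcomp Require Import all_boot all_order all_algebra.
From mathcomp Require Import classical_sets reals.
From mathcomp Require Import zify ring lra polyrcf.

Set Implicit Arguments.
Unset Strict Implicit.
Unset Printing Implicit Defensive.

(** * Regular factors by edge switching *)

Section EdgeOperations.
Variable T : finType.
Implicit Types (F G : sgraph T) (u v w x y : T).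

Lemma degreeE F v : degree F v = \sum_u F v u.
Proof. by rewrite /degree -sum1dep_card big_mkcond; apply: eq_bigr=> u _; case: (F v u). Qed.

Lemma degree_lt F v : degree F v < #|T|.
Proof.
rewrite /degree; apply: proper_card; apply/properP; split; first by apply/fintype.subsetP.
by exists v; rewrite ?inE // adj_irrefl.
Qed.

(** Each edge is counted once from its end of smaller [enum_rank] and once from the other. *)
Lemma handshake F : ~~ odd (\sum_v degree F v).
Proof.
pose lt u w := enum_rank u < enum_rank w.
suff -> : \sum_v degree F v = (\sum_u \sum_w (F u w && lt u w)).*2 by rewrite odd_double.
rewrite -addnn {2}exchange_big -big_split /=; apply: eq_bigr => u _.
rewrite degreeE -big_split; apply: eq_bigr => w _ /=.
rewrite [F w u]adj_sym /lt; case: (eqVneq u w) => [->|uw]; first by rewrite adj_irrefl.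
have : enum_rank u != enum_rank w :> nat.
  by apply: contra_neq uw => /val_inj /enum_rank_inj.
by case: (F u w) => //=; case: ltngtP.
Qed.

Definition edge_rel x y : rel T :=
  fun u w => ((u == x) && (w == y)) || ((u == y) && (w == x)).

(** The guard [x != y] makes the operation total: adding a loop changes nothing. *)
Definition add_rel F x y : rel T := fun u w => F u w || (x != y) && edge_rel x y u w.

Fact add_sym F x y : symmetric (add_rel F x y).
Proof.
move=> u w; rewrite /add_rel /edge_rel adj_sym.
by rewrite orbC [(u == y) && _]andbC [(u == x) && _]andbC orbC [X in _ && X]orbC.
Qed.

Fact add_irrefl F x y : irreflexive (add_rel F x y).
Proof.
move=> u; rewrite /add_rel /edge_rel adj_irrefl /=.
by case: (eqVneq u x) => [->|_]; case: (eqVneq x y) => //= ; rewrite andbF.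
Qed.

Definition add_edge F x y := SGraph (@add_sym F x y) (@add_irrefl F x y).

Definition del_rel F x y : rel T := fun u w => F u w && ~~ edge_rel x y u w.

Fact del_sym F x y : symmetric (del_rel F x y).
Proof.
move=> u w; rewrite /del_rel /edge_rel adj_sym.
by rewrite [(u == y) && _]andbC [(u == x) && _]andbC orbC.
Qed.

Fact del_irrefl F x y : irreflexive (del_rel F x y).
Proof. by move=> u; rewrite /del_rel adj_irrefl. Qed.

Definition del_edge F x y := SGraph (@del_sym F x y) (@del_irrefl F x y).

Lemma edge_rel_sum x y u : x != y -> \sum_w edge_rel x y u w = (u == x) + (u == y).
Proof.
move=> xy; rewrite /edge_rel.
have sum1 z : \sum_(w : T) (w == z) = 1.
  by rewrite -big_mkcond /= (big_pred1 z).
case: (eqVneq u x) => [->|ux] /=; last first.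
  by case: (u == y) => /=; [exact: sum1 | exact: big1].
rewrite (negbTE xy) /= addn0 -[RHS](sum1 y).
by apply: eq_bigr => w _; rewrite orbF.
Qed.

Lemma degree_add F x y u : x != y -> ~~ F x y ->
  degree (add_edge F x y) u = degree F u + (u == x) + (u == y).
Proof.
move=> xy Fxy; rewrite -addnA -(edge_rel_sum u xy) !degreeE -big_split /=.
apply: eq_bigr => w _; rewrite /add_rel xy /=.
case Fuw: (F u w) => //=; case E: (edge_rel x y u w) => //.
by case/orP: E Fxy => /andP[/eqP<- /eqP<-]; rewrite ?Fuw // adj_sym Fuw.
Qed.

Lemma degree_del F x y u : F x y ->
  degree (del_edge F x y) u + (u == x) + (u == y) = degree F u.
Proof.
move=> Fxy.
have xy : x != y by apply: contraTneq Fxy => ->; rewrite adj_irrefl.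
rewrite -addnA -(edge_rel_sum u xy) !degreeE -big_split /=.
apply: eq_bigr => w _; rewrite /del_rel.
case E: (edge_rel x y u w); rewrite ?andbT ?addn0 //= andbF.
by case/orP: E => /andP[/eqP-> /eqP->]; rewrite ?Fxy // adj_sym Fxy.
Qed.

Lemma sub_add F G x y : subrel F G -> G x y -> subrel (add_edge F x y) G.
Proof.
move=> FG Gxy u w /orP[/FG//|/andP[_ /orP[]]] /andP[/eqP-> /eqP->] //.
by rewrite adj_sym.
Qed.

Lemma sub_del F G x y : subrel F G -> subrel (del_edge F x y) G.
Proof. by move=> FG u w /andP[/FG]. Qed.

End EdgeOperations.

(** * Augmentation of partial factors *)

Section Factor.
Variables (T : finType) (G : sgraph T) (a : nat) (v : T).
Implicit Types (F : sgraph T) (u w x y : T).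

(* Saturation of [v] is part of the invariant because [v] is the only
   vertex whose degree may be too small for the exchange argument. *)
Definition partial_factor F :=
  [/\ subrel F G, forall u, degree F u <= a & degree F v = a].

Definition free_nbrs F x := [set u | G x u && ~~ F x u].

Lemma card_free_nbrs F x : subrel F G -> #|free_nbrs F x| + degree F x = degree G x.
Proof.
move=> FG; rewrite /degree /free_nbrs -!sum1dep_card.
rewrite [RHS](bigID (F x)) /= addnC; congr (_ + _); apply: eq_bigl => u.
by case E: (F x u); rewrite ?andbF // (FG _ _ E).
Qed.

Lemma augment_add F x y : partial_factor F -> degree F x < a -> degree F y < a ->
  y \in free_nbrs F x ->
  exists2 F', partial_factor F' & \sum_u degree F u < \sum_u degree F' u.
Proof.
move=> [FG Fa Fv] xa ya; rewrite inE => /andP[Gxy Fxy].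
have xy : x != y by apply: contraTneq Gxy => ->; rewrite adj_irrefl.
have degE u : degree (add_edge F x y) u = degree F u + (u == x) + (u == y).
  exact: degree_add.
exists (add_edge F x y); first split.
- exact: sub_add.
- move=> u; rewrite degE; have := Fa u.
  case: (eqVneq u x) => [->|_]; first by rewrite (negbTE xy) addn0 addn1.
  by case: (eqVneq u y) => [->|_]; rewrite ?addn0 ?addn1.
- rewrite degE; have [/eqP vx|_] := eqVneq v x; first by move: xa; rewrite -(eqP vx) Fv ltnn.
  by have [vy|_] := eqVneq v y; rewrite ?addn0 //; move: ya; rewrite -vy Fv ltnn.
- rewrite (eq_bigr _ (fun u _ => degE u)) !big_split /=.
  rewrite -addnA -[X in X < _]addn0 ltn_add2l.
  by rewrite (bigD1 x) //= eqxx.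
Qed.

(** Replacing [u w] by [x u] and [y w] keeps the degrees of [u] and [w] and raises those of [x] and
    [y] by one; [v], being saturated, is neither [x] nor [y]. *)
Lemma augment_switch F x y u w : partial_factor F -> x != y ->
  degree F x < a -> degree F y < a ->
  F u w -> u \in free_nbrs F x -> w \in free_nbrs F y ->
  exists2 F', partial_factor F' & \sum_u degree F u < \sum_u degree F' u.
Proof.
move=> [FG Fa Fv] xy xa ya Fuw; rewrite !inE => /andP[Gxu Fxu] /andP[Gyw Fyw].
have xu : x != u by apply: contraTneq Gxu => ->; rewrite adj_irrefl.
have yw : y != w by apply: contraTneq Gyw => ->; rewrite adj_irrefl.
have xw : x != w by apply: contraNneq Fxu => ->; rewrite adj_sym.
have yu : y != u by apply: contraNneq Fyw => ->.
have vx : v != x by apply: contraTneq xa => <-; rewrite Fv ltnn.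
have vy : v != y by apply: contraTneq ya => <-; rewrite Fv ltnn.
pose F1 := del_edge F u w; pose F2 := add_edge F1 x u; pose F3 := add_edge F2 y w.
have F1xu : ~~ F1 x u by rewrite /F1 /= /del_rel (negbTE Fxu).
have F2yw : ~~ F2 y w.
  rewrite /F2 /= /add_rel /F1 /= /del_rel (negbTE Fyw) /= /edge_rel.
  by rewrite (negbTE yu) [y == x]eq_sym (negbTE xy) andbF.
have degE t : degree F3 t = degree F t + (t == x) + (t == y).
  rewrite (degree_add _ yw F2yw) (degree_add _ xu F1xu) -(degree_del t Fuw) -/F1.
  by move: (degree F1 t) (t == x) (t == y) (t == u) (t == w) => *; clear; lia.
exists F3; first split.
- by do 2![apply: sub_add => //]; apply: sub_del.
- move=> t; rewrite degE; have := Fa t.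
  case: (eqVneq t x) => [->|_]; first by rewrite (negbTE xy) addn0 addn1.
  by case: (eqVneq t y) => [->|_]; rewrite ?addn0 ?addn1.
- by rewrite degE (negbTE vx) (negbTE vy) !addn0.
- rewrite (eq_bigr _ (fun t _ => degE t)) !big_split /=.
  rewrite -addnA -[X in X < _]addn0 ltn_add2l.
  by rewrite (bigD1 x) //= eqxx.
Qed.

Hypothesis deg2 : forall x y, x != y -> x != v -> y != v ->
  #|T| + 2 * a <= degree G x + degree G y + 2.

Lemma augment_two F x y : partial_factor F -> x != y ->
  degree F x < a -> degree F y < a ->
  exists2 F', partial_factor F' & \sum_u degree F u < \sum_u degree F' u.
Proof.
move=> PF xy xa ya; have [FG Fa Fv] := PF.
have xv : x != v by apply: contraTneq xa => ->; rewrite Fv ltnn.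
have yv : y != v by apply: contraTneq ya => ->; rewrite Fv ltnn.
case: (boolP [exists u in free_nbrs F x, degree F u < a]) => [/existsP[u /andP[ux ua]]|].
  exact: (augment_add PF xa ua ux).
rewrite negb_exists => /forallP satx.
case: (boolP [exists u in free_nbrs F x, [exists w in free_nbrs F y, F u w]]).
  case/existsP=> u /andP[ux /existsP[w /andP[wy Fuw]]].
  exact: (augment_switch PF xy xa ya Fuw ux wy).
rewrite negb_exists => /forallP noedge.
(* The edges of [F] leaving the saturated set [free_nbrs F x] all end outside
   [free_nbrs F y], where there is not enough room since [y] is unsaturated. *)
have sat : \sum_(u in free_nbrs F x) degree F u = #|free_nbrs F x| * a.
  rewrite -sum_nat_const; apply: eq_bigr => u ux.
  by apply/eqP; rewrite eqn_leq Fa /=; have := satx u; rewrite ux /= -leqNgt.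
have out : \sum_(u in free_nbrs F x) degree F u <= \sum_(w in ~: free_nbrs F y) degree F w.
  rewrite (eq_bigr _ (fun u _ => degreeE F u)) exchange_big /=.
  rewrite (bigID (mem (free_nbrs F y))) /= big1 ?add0n; last first.
    move=> w wy; rewrite big1 // => u ux; have := noedge u; rewrite ux /= negb_exists.
    by move/forallP/(_ w); rewrite wy /=; case: (F u w).
  rewrite [X in _ <= X](eq_bigl (fun w => w \notin free_nbrs F y)); last first.
    by move=> w; rewrite finset.in_setC.
  apply: leq_sum => w _; rewrite degreeE [X in _ <= X](bigID (mem (free_nbrs F x))) /=.
  by apply: leq_trans (leq_addr _ _); apply: leq_sum => u _; rewrite adj_sym.
have yC : y \in ~: free_nbrs F y by rewrite !inE adj_irrefl.
have lt : \sum_(w in ~: free_nbrs F y) degree F w < #|~: free_nbrs F y| * a.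
  rewrite -sum_nat_const (bigD1 y) //= [X in _ < X](bigD1 y) //=.
  by rewrite -addSn; apply: leq_add => //; apply: leq_sum.
(* The counts give [#|free_nbrs F x| + #|free_nbrs F y| < #|T|], whereas [deg2] and the degrees at
   most [a - 1] of [x] and [y] in [F] make this sum at least [#|T|]. *)
have := cardsC (free_nbrs F y).
have := card_free_nbrs x FG; have := card_free_nbrs y FG.
have := deg2 xy xv yv; move: lt out; rewrite sat.
move: (#|free_nbrs F x|) (#|free_nbrs F y|) (#|~: free_nbrs F y|) xa ya.
move: (degree F x) (degree F y) (degree G x) (degree G y) #|T|; clear; nia.
Qed.

Lemma augment_one F x : ~~ odd (#|T| * a) -> 2 < #|T| -> partial_factor F ->
  degree F x < a -> (forall u, u != x -> degree F u = a) ->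
  exists2 F', partial_factor F' & \sum_u degree F u < \sum_u degree F' u.
Proof.
move=> even_na n3 PF xa sat; have [FG Fa Fv] := PF.
have xv : x != v by apply: contraTneq xa => ->; rewrite Fv ltnn.
(* All other vertices have degree [a], so the handshake lemma and the evenness of [#|T| * a] give
   [degree F x] the parity of [a]. *)
have x2 : degree F x + 2 <= a.
  suff : odd (degree F x) = odd a by move: (degree F x) xa; clear; lia.
  have := handshake F; rewrite (bigD1 x) //= (eq_bigr _ sat) sum_nat_const.
  rewrite (cardC1 x : #|[pred y | y != x]| = _).
  move: even_na xa n3; case: #|T| => [|[|n]] //=; rewrite !oddD oddM /=.
  by case: (odd (degree F x)); case: (odd a); case: (odd n).
(* [y] serves to bound [degree G x] from below by [2 * a - 1], through [degree G y <= #|T| - 1]. *)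
have [y yx yv] : exists2 y, y != x & y != v.
  have : 0 < #|~: [set x; v]| by rewrite cardsCs finset.setCK cards2 xv subn_gt0.
  by case/card_gt0P=> y; rewrite !inE negb_or => /andP[]; exists y.
(* [x] has at least [a + 1] free neighbours, more than the [a] neighbours of [v] in [F]; avoiding
   the latter ensures [w != v] below, so that [v] stays saturated. *)
have [u ux uv] : exists2 u, u \in free_nbrs F x & ~~ F v u.
  have : 0 < #|free_nbrs F x :\: [set u | F v u]|.
    have := cardsID [set u | F v u] (free_nbrs F x).
    have := subset_leq_card (finset.subsetIr (free_nbrs F x) [set u | F v u]).
    rewrite -/(degree F v) Fv; have := card_free_nbrs x FG.
    rewrite eq_sym in yx; have := deg2 yx xv yv; have := degree_lt G y.
    by move: x2; clear; lia.
  by case/card_gt0P=> u; rewrite !inE => /andP[? ?]; exists u; rewrite ?inE.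
move: (ux); rewrite inE => /andP[Gxu Fxu].
have ux' : u != x by apply: contraTneq Gxu => ->; rewrite adj_irrefl.
have [w Fuw] : exists w, F u w.
  have : 0 < degree F u by rewrite sat // (leq_ltn_trans _ xa).
  by case/card_gt0P=> w; rewrite inE; exists w.
have wu : w != u by apply: contraTneq Fuw => ->; rewrite adj_irrefl.
have wx : w != x by apply: contraNneq Fxu => <-; rewrite adj_sym.
have wv : w != v by apply: contraNneq uv => <-; rewrite adj_sym.
pose F1 := del_edge F u w; pose F2 := add_edge F1 x u.
have F1xu : ~~ F1 x u by rewrite /F1 /= /del_rel (negbTE Fxu).
have degE t : degree F2 t + (t == w) = degree F t + (t == x).
  have xu : x != u by rewrite eq_sym.
  rewrite (degree_add _ xu F1xu) -(degree_del t Fuw) -/F1.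
  by move: (degree F1 t) (t == x) (t == u) (t == w) => *; clear; lia.
have wE := degE w; rewrite eqxx (negbTE wx) (sat w wx) in wE.
have xE := degE x; rewrite eqxx [x == w]eq_sym (negbTE wx) in xE.
have PF2 : partial_factor F2.
  split; first by apply: sub_add => //; apply: sub_del.
    move=> t; have := degE t; have := Fa t; case: (eqVneq t x) => [->|_].
      by move: x2; clear; lia.
    by clear; lia.
  by have := degE v; rewrite eq_sym (negbTE wv) eq_sym (negbTE xv) Fv !addn0.
have sumE : \sum_t degree F2 t = \sum_t degree F t.
  apply/eqP; rewrite -(eqn_add2r 1); apply/eqP.
  have s1 z : \sum_(t : T) (t == z) = 1 by rewrite -big_mkcond /= (big_pred1 z).
  rewrite -{1}(s1 w) -(s1 x) -!big_split /=; apply: eq_bigr => t _; exact: degE.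
(* Both [x] and [w] are now unsaturated, with the same degree sum as before the exchange. *)
rewrite -sumE; apply: (augment_two PF2 (x := x) (y := w)); rewrite 1?eq_sym //.
  by move: x2 xE; clear; lia.
by move: wE x2; clear; lia.
Qed.

Lemma partial_factor_extend F : ~~ odd (#|T| * a) -> 2 < #|T| -> partial_factor F ->
  exists2 F' : sgraph T, subrel F' G & forall u, degree F' u = a.
Proof.
move=> even_na n3.
(* Induction on the deficit of the degree sum, which each augmentation lowers. *)
have [k] := ubnP (#|T| * a - \sum_u degree F u); elim: k F => // k IH F ltk PF.
have [FG Fa Fv] := PF.
have next F' : partial_factor F' -> \sum_u degree F u < \sum_u degree F' u ->
    exists2 F' : sgraph T, subrel F' G & forall u, degree F' u = a.
  move=> PF' lt; apply: (IH F') => //.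
  have : \sum_u degree F' u <= #|T| * a.
    by rewrite -sum_nat_const; apply: leq_sum => u _; case: PF'.
  by move: ltk lt; clear; lia.
case: (boolP [exists x, degree F x < a]) => [/existsP[x xa]|]; last first.
  rewrite negb_exists => /forallP sat; exists F => // u.
  by apply/eqP; rewrite eqn_leq Fa leqNgt sat.
case: (boolP [exists y, (y != x) && (degree F y < a)]) => [/existsP[y /andP[yx ya]]|].
  by rewrite eq_sym in yx; have [F'] := augment_two PF yx xa ya; exact: next.
rewrite negb_exists => /forallP sat.
have [|F'] := augment_one even_na n3 PF xa; last exact: next.
by move=> u ux; apply/eqP; rewrite eqn_leq Fa leqNgt; have := sat u; rewrite ux.
Qed.

End Factor.

(** * The initial star *)

Section Star.
Variables (T : finType) (v : T) (A : {set T}).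

Definition star_rel : rel T :=
  fun u w => (u == v) && (w \in A :\ v) || (w == v) && (u \in A :\ v).

Fact star_sym : symmetric star_rel.
Proof. by move=> u w; rewrite /star_rel orbC. Qed.

Fact star_irrefl : irreflexive star_rel.
Proof. by move=> u; rewrite /star_rel !inE; case: eqP. Qed.

Definition star := SGraph star_sym star_irrefl.

Lemma degree_star_center : v \notin A -> degree star v = #|A|.
Proof.
move=> vA; apply: eq_card => u; rewrite inE /= /star_rel eqxx !inE eqxx /= andbF orbF.
by case: (eqVneq u v) => [->|] //=; rewrite (negbTE vA).
Qed.

Lemma degree_star_leaf u : u != v -> degree star u <= 1.
Proof.
move=> uv; rewrite /degree -(cards1 v); apply: subset_leq_card.
by apply/fintype.subsetP=> w; rewrite !inE /= /star_rel (negbTE uv) /= => /andP[].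
Qed.

End Star.

Lemma regular_factor (T : finType) (G : sgraph T) (a : nat) (v : T) :
  0 < a -> ~~ odd (#|T| * a) -> 2 < #|T| -> a <= degree G v ->
  (forall x y, x != y -> x != v -> y != v ->
     #|T| + 2 * a <= degree G x + degree G y + 2) ->
  exists2 F : sgraph T, subrel F G & forall u, degree F u = a.
Proof.
move=> a0 even_na n3 /card_geqP[s [us sa sN]] deg2.
pose A := [set u in s].
have cA : #|A| = a by rewrite cardsE -sa; apply/card_uniqP.
have GA u : u \in A -> G v u by rewrite inE => /sN; rewrite inE.
have vA : v \notin A by apply/negP=> /GA; rewrite adj_irrefl.
apply: (partial_factor_extend (F := star v A) deg2 even_na n3); split.
- move=> u w /orP[] /andP[/eqP->] /finset.setD1P[_ /GA] //.
  by rewrite adj_sym.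
- move=> u; case: (eqVneq u v) => [->|uv]; first by rewrite degree_star_center ?cA.
  by apply: leq_trans (degree_star_leaf _ uv) _.
- by rewrite degree_star_center.
Qed.

(** * Degrees in the complement *)

Section Complement.
Variables (T : finType) (G : sgraph T).

Definition compl_rel : rel T := fun u w => (u != w) && ~~ G u w.

Fact compl_sym : symmetric compl_rel.
Proof. by move=> u w; rewrite /compl_rel eq_sym adj_sym. Qed.

Fact compl_irrefl : irreflexive compl_rel.
Proof. by move=> u; rewrite /compl_rel eqxx. Qed.

Definition compl := SGraph compl_sym compl_irrefl.

Lemma degree_compl u : degree compl u + degree G u = #|T| - 1.
Proof.
rewrite !degreeE -big_split /= subn1 -(cardC1 u) -sum1_card [RHS]big_mkcond /=.
apply: eq_bigr => w _; rewrite /compl_rel !inE eq_sym.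
by case: eqVneq => [->|]; rewrite ?adj_irrefl //; case: (G u w).
Qed.

(** The three degrees count every edge meeting [x], [y], [z] once, except that the at most three
    edges among them are counted twice. *)
Lemma degree_three x y z : x != y -> x != z -> y != z ->
  2 * (degree G x + degree G y + degree G z) <= \sum_u degree G u + 6.
Proof.
move=> xy xz yz.
pose f u := G x u + G y u + G z u.
have fE : \sum_u f u = degree G x + degree G y + degree G z.
  by rewrite !degreeE -!big_split.
have fd u : f u <= degree G u.
  rewrite degreeE (bigD1 x) //= (bigD1 y) 1?eq_sym //= (bigD1 z) /=; last first.
    by rewrite eq_sym xz eq_sym.
  by rewrite !addnA [G u x]adj_sym [G u y]adj_sym [G u z]adj_sym leq_addr.
have atS z' c : \sum_(u : T) (u == z') * c = c.
  by rewrite (bigD1 z') //= eqxx mul1n big1 ?addn0 // => u /negbTE->.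
(* At each of the three vertices [f] is at most [2], and elsewhere it is at most the degree; the
   indicator terms combine both bounds into one sum. *)
have: \sum_u (f u + (u == x) * degree G x + (u == y) * degree G y + (u == z) * degree G z)
    <= \sum_u (degree G u + (u == x) * 2 + (u == y) * 2 + (u == z) * 2).
  apply: leq_sum => u _; case: (eqVneq u x) => [->|ux].
    rewrite (negbTE xy) (negbTE xz) /f adj_irrefl.
    by case: (G y x) (G z x) => [] []; clear; lia.
  case: (eqVneq u y) => [->|uy].
    rewrite (negbTE yz) /f adj_irrefl.
    by case: (G x y) (G z y) => [] []; clear; lia.
  case: (eqVneq u z) => [->|uz].
    rewrite /f adj_irrefl.
    by case: (G x z) (G y z) => [] []; clear; lia.
  by rewrite !mul0n !addn0.
by clearbody f; rewrite !big_split /= !atS fE; clear; lia.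
Qed.

End Complement.

Import Order.TTheory GRing.Theory Num.Theory.
Local Open Scope ring_scope.

(** * Eigenvalues and the spectral radius *)

Section Spectral.
Variables (R : realType) (T : finType) (G : sgraph T).
Implicit Types (f : T -> R) (l : R).

(** Eigenvectors as functions on the vertices, free of the enumeration of [T] behind [adjmx]. *)
Definition eigenfun l f :=
  (exists i, f i != 0) /\ forall i, \sum_(j | G i j) f j = l * f i.

Lemma eigenvalue_eigenfun l :
  eigenvalue (adjmx R G) l <-> exists f, eigenfun l f.
Proof.
have sumE (g : T -> R) (i : T) :
    \sum_(j | G i j) g j = \sum_(k < #|T|) g (enum_val k) * (G (enum_val k) i)%:R.
  rewrite big_mkcond /= (reindex (fun k : 'I_#|T| => enum_val k)) /=; last first.
    by apply: onW_bij; apply: enum_val_bij.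
  by apply: eq_bigr => k _; rewrite adj_sym; case: (G _ _); rewrite ?mulr1 ?mulr0.
split=> [/eigenvalueP[w wA w0]|[f [[i fi] fA]]].
  exists (fun i => w 0 (enum_rank i)); split.
    have [k wk] : exists k, w 0 k != 0.
      by apply/existsP; apply: contra_neqT w0; rewrite negb_exists => /forallP w0;
        apply/rowP=> k; rewrite mxE; apply/eqP; rewrite -[_ == _]negbK.
    by exists (enum_val k); rewrite enum_valK.
  move=> i; rewrite sumE; have /rowP/(_ (enum_rank i)) := wA; rewrite !mxE => <-.
  by apply: eq_bigr => k _; rewrite enum_valK mxE enum_rankK.
apply/eigenvalueP; exists (\row_k f (enum_val k)).
  apply/rowP=> k; rewrite !mxE -fA sumE; apply: eq_bigr => j _.
  by rewrite !mxE.
by apply: contra_neq fi => /rowP/(_ (enum_rank i)); rewrite !mxE enum_rankK.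
Qed.

Lemma sum_nbrs_const (c : R) j : \sum_(i | G j i) c = (degree G j)%:R * c.
Proof.
rewrite degreeE natr_sum mulr_suml big_mkcond /=; apply: eq_bigr => i _.
by case: (G j i); rewrite ?mul1r ?mul0r.
Qed.

Lemma sum_nbrs f : \sum_i \sum_(j | G i j) f j = \sum_j (degree G j)%:R * f j.
Proof.
rewrite (exchange_big_dep xpredT) //=; apply: eq_bigr => j _.
by rewrite -sum_nbrs_const; apply: eq_bigl => i; rewrite adj_sym.
Qed.

(** Cauchy-Schwarz against the constant function, from [2 * f j * f k <= f j ^+ 2 + f k ^+ 2] over
    all pairs of neighbours. *)
Lemma sqr_sum_nbrs_le f i :
  (\sum_(j | G i j) f j) ^+ 2 <= (degree G i)%:R * \sum_(j | G i j) f j ^+ 2.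
Proof.
set Q := \sum_(j | _) _ ^+ 2.
have -> : (degree G i)%:R * Q =
    \sum_(j | G i j) \sum_(k | G i k) (f j ^+ 2 + f k ^+ 2) / 2.
  under eq_bigr do rewrite -mulr_suml big_split /= sum_nbrs_const -/Q.
  rewrite -mulr_suml big_split /= -mulr_sumr sum_nbrs_const -/Q; lra.
rewrite expr2 big_distrlr /=; apply: ler_sum => j _; apply: ler_sum => k _.
by have := sqr_ge0 (f j - f k); lra.
Qed.

(* Stanley's bound [l * (l + 1) <= 2 * e(G)]. *)
Lemma eigenvalue_degree_sum l : eigenvalue (adjmx R G) l ->
  l ^+ 2 + l <= (\sum_i degree G i)%:R.
Proof.
move=> /eigenvalue_eigenfun[f [[i0 fi0] fA]].
pose Q := \sum_i f i ^+ 2.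
have Q0 : 0 < Q.
  rewrite /Q (bigD1 i0) //=; apply: ltr_wpDr; last by rewrite exprn_even_gt0.
  by apply: sumr_ge0 => i _; apply: sqr_ge0.
rewrite -(ler_pM2r Q0) natr_sum.
(* The quadratic form of the Laplacian is nonnegative. *)
have quad : l * Q <= \sum_i (degree G i)%:R * f i ^+ 2.
  have -> : l * Q = \sum_i \sum_(j | G i j) f i * f j.
    by rewrite mulr_sumr; apply: eq_bigr => i _; rewrite -mulr_sumr fA; ring.
  rewrite -(ler_pM2l (ltr0Sn R 1)).
  have -> : 2 * \sum_i (degree G i)%:R * f i ^+ 2 =
      \sum_i \sum_(j | G i j) (f i ^+ 2 + f j ^+ 2).
    under [RHS]eq_bigr do rewrite big_split /=.
    rewrite big_split /= sum_nbrs mulr_natl mulr2n; congr (_ + _).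
    by apply: eq_bigr => i _; rewrite sum_nbrs_const.
  rewrite mulr_sumr; apply: ler_sum => i _; rewrite mulr_sumr; apply: ler_sum => j _.
  by have := sqr_ge0 (f i - f j); lra.
(* Cauchy-Schwarz applied to the eigenvalue equation at [i]; the neighbours of [i] exclude [i]
   itself, whence the extra term [f i ^+ 2]. *)
have row i : l ^+ 2 * f i ^+ 2 + (degree G i)%:R * f i ^+ 2 <= (degree G i)%:R * Q.
  have QE : \sum_(j | G i j) f j ^+ 2 <= Q - f i ^+ 2.
    rewrite /Q [in leRHS](bigD1 i) //= [leRHS]addrC addKr [leRHS](bigID (G i)) /=.
    rewrite [X in _ <= X + _](eq_bigl (G i)); last first.
      by move=> j; case: eqVneq => [->|]; rewrite ?adj_irrefl.
    by rewrite lerDl; apply: sumr_ge0 => j _; apply: sqr_ge0.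
  rewrite -exprMn -fA -lerBrDr -mulrBr.
  apply: le_trans (sqr_sum_nbrs_le _ _) _.
  by rewrite ler_wpM2l.
(* In the sum of all rows, [quad] bounds the second term from below by [l * Q]. *)
have := ler_sum (index_enum T) (fun i (_ : true) => row i).
rewrite big_split /= -mulr_sumr -mulr_suml -/Q; move: quad.
by rewrite mulrDl; lra.
Qed.

Lemma eigenvalues_finite : exists s : seq R, forall l, eigenvalue (adjmx R G) l = (l \in s).
Proof.
exists (rootsR (char_poly (adjmx R G))) => l; rewrite eigenvalue_root_char.
have p0 : char_poly (adjmx R G) != 0 by rewrite monic_neq0 // char_poly_monic.
by have := roots_on_rootsR p0 l; rewrite in_itv.
Qed.

Lemma spectral_radius_ge l : eigenvalue (adjmx R G) l -> l <= spectral_radius R G.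
Proof.
move=> El; apply: ub_le_sup => //; have [s sE] := eigenvalues_finite.
exists (\sum_(x <- s) `|x|) => x /=; rewrite sE => xs.
apply: le_trans (ler_norm x) _; rewrite (big_rem x) //= lerDl.
by apply: sumr_ge0.
Qed.

(** If all eigenvalues were below [l], so would be their maximum with [0]; the positivity of [l]
    also covers the empty set, whose supremum is [0] by convention. *)
Lemma spectral_radius_attained l : 0 < l -> l <= spectral_radius R G ->
  exists2 m, eigenvalue (adjmx R G) m & l <= m.
Proof.
move=> l0 lG; have [s sE] := eigenvalues_finite.
case: (boolP (has (fun m => l <= m) s)) => [/hasP[m ms lm]|/hasPn small].
  by exists m; rewrite ?sE.
pose b := \big[Num.max/0]_(m <- s) m.
have bl : b < l.
  rewrite /b big_seq; apply: (big_ind (fun x => x < l)) => // [x y xl yl|m /small].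
    by rewrite gt_max xl yl.
  by rewrite -ltNge.
have : spectral_radius R G <= b.
  rewrite /spectral_radius; set E := [set x | _]%classic.
  have [->|/set0P E0] := eqVneq E classical_sets.set0.
    by rewrite sup0; apply: bigmax_ge_id.
  apply: ge_sup => // x; rewrite /E /= sE => xs.
  by rewrite /b; apply: le_bigmax_seq.
by rewrite leNgt (lt_le_trans bl lG).
Qed.

End Spectral.

(** * The extremal graph *)

(* Pairing [|f|] with the nonnegative eigenvector [z] of the larger graph forces
   equality in [l * |f i| <= \sum_(G i j) |f j| <= \sum_(H i j) |f j|] wherever
   [z] is positive. *)
Lemma subgraph_eigenfun (R : realType) (T : finType) (G H : sgraph T)
    (l0 l : R) (z f : T -> R) :
  subrel G H -> (forall i, 0 <= z i) ->
  (forall i, \sum_(j | H i j) z j = l0 * z i) -> 0 <= l -> l0 <= l ->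
  (forall i, \sum_(j | G i j) f j = l * f i) ->
  forall i, 0 < z i -> \sum_(j | H i j) `|f j| = l * `|f i| /\
    forall j, H i j -> f j != 0 -> G i j.
Proof.
move=> GH z0 Hz l_ge0 l0l Gf.
have Gle i : l * `|f i| <= \sum_(j | G i j) `|f j|.
  by rewrite -[l]ger0_norm // -normrM -Gf; apply: ler_norm_sum.
have HG i : \sum_(j | H i j) `|f j| =
    \sum_(j | G i j) `|f j| + \sum_(j | H i j && ~~ G i j) `|f j|.
  rewrite (bigID (G i)) /=; congr (_ + _); apply: eq_bigl => j.
  by case E: (G i j); rewrite ?andbF // (GH _ _ E).
have rest0 i : 0 <= \sum_(j | H i j && ~~ G i j) `|f j|.
  by apply: sumr_ge0.
pose gap i := z i * (\sum_(j | H i j) `|f j| - l * `|f i|).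
have gap0 i : true -> 0 <= gap i.
  move=> _; rewrite /gap mulr_ge0 // HG; have := Gle i; have := rest0 i; lra.
(* The symmetry of [H] moves the adjacency sum from [f] to its eigenvector [z], which produces the
   factor [l0 - l]. *)
have sum_gap : \sum_i gap i <= 0.
  have -> : \sum_i gap i = (l0 - l) * \sum_i z i * `|f i|.
    rewrite /gap mulr_sumr; under eq_bigr do rewrite mulrBr mulr_sumr.
    rewrite big_split /= (exchange_big_dep xpredT) //= -big_split /=.
    apply: eq_bigr => i _; rewrite -mulr_suml (eq_bigl (H i)); last first.
      by move=> j; rewrite adj_sym.
    by rewrite Hz; ring.
  rewrite mulr_le0_ge0 ?subr_le0 //; apply: sumr_ge0 => i _; exact: mulr_ge0.
have gapE i : gap i = 0.
  apply: (psumr_eq0P gap0) => //; apply/eqP; rewrite eq_le sum_gap.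
  exact: sumr_ge0.
move=> i zi.
have eqi : \sum_(j | H i j) `|f j| = l * `|f i|.
  apply/eqP; rewrite -subr_eq0; have /eqP := gapE i.
  by rewrite mulf_eq0 (gt_eqF zi).
split=> // j Hij; apply: contra_neqT => Gij.
have rest : \sum_(j | H i j && ~~ G i j) `|f j| = 0.
  apply: le_anti; rewrite rest0 andbT; have := Gle i; move: eqi; rewrite HG; lra.
apply/eqP/normr0P; apply: (psumr_eq0P _ rest); rewrite ?Hij //.
Qed.

(* The cubic comes from the three-class quotient of [extremal] below. *)
Lemma extremal_cubic_root (R : realType) (k m : nat) : (0 < m)%N ->
  exists2 l : R, (k + m)%:R - 1 <= l &
    k%:R * m%:R * l = (l - m%:R + 1) * ((l - k%:R + 1) * l - k%:R).
Proof.
move=> m0; have k_ge0 : (0 : R) <= k%:R by [].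
have m_ge1 : (1 : R) <= m%:R by rewrite ler1n.
move: (k%:R : R) (m%:R : R) (natrD R k m) k_ge0 m_ge1 => x y -> x0 y1.
pose p := ('X - y%:P + 1) * (('X - x%:P + 1) * 'X - x%:P) - (x * y)%:P * 'X.
have pE l : p.[l] = (l - y + 1) * ((l - x + 1) * l - x) - x * y * l.
  by rewrite /p !hornerE.
have le : x + y - 1 <= x + y by lra.
(* Intermediate values on an interval of length one: the cubic is at most [0] at its left end and at
   least [0] at its right end. *)
have [|l /andP[l1 _] /rootP] := poly_ivt (p := p) le.
  have -> : p.[x + y - 1] = - x ^+ 2 by rewrite pE; ring.
  have -> : p.[x + y] = (x + y) * (x + y + 1) - x * (x + 1) by rewrite pE; ring.
  by rewrite oppr_le0 sqr_ge0 /=; nra.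
by rewrite pE => pl; exists l => //; lra.
Qed.

Section Extremal.
Variables (R : realType) (k m : nat).
Hypothesis m2 : (1 < m)%N.

(** [Hgraph n a] with [k = a - 1] and [m = n - a], free of truncated subtractions. *)
Definition extremal := gjoin (complete k) (gunion (complete 1) (complete m)).
Let V := ('I_k + ('I_1 + 'I_m))%type.
Let c : V := inr (inl ord0).

Lemma extremal_clique (i j : V) : i != c -> j != c -> i != j -> extremal i j.
Proof.
move: i j => [i|[i|i]] [j|[j|j]] //=; rewrite ?(ord1 i) ?(ord1 j) //.
Qed.

Variable l : R.
Hypothesis l_ge : (k + m)%:R - 1 <= l.
Hypothesis lE : k%:R * m%:R * l = (l - m%:R + 1) * ((l - k%:R + 1) * l - k%:R).

(* Scaled so that it does not vanish when [k = 0], where [extremal] is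
   disconnected and the entry at the isolated vertex has to be [0]. *)
Definition extremal_vec (i : V) : R :=
  match i with
  | inl _ => m%:R * l
  | inr (inl _) => m%:R * k%:R
  | inr (inr _) => (l - k%:R + 1) * l - k%:R
  end.

Let m_ge2 : (2 : R) <= m%:R. Proof. by rewrite ler_nat. Qed.
Let k_ge0 : (0 : R) <= k%:R. Proof. by []. Qed.

Lemma extremal_vec_ge0 i : 0 <= extremal_vec i.
Proof.
have := m_ge2; have := k_ge0; have := l_ge; rewrite natrD.
by case: i => [i|[i|i]] /=; nra.
Qed.

Lemma extremal_vec_gt0 i : i != c -> 0 < extremal_vec i.
Proof.
have := m_ge2; have := k_ge0; have := l_ge; rewrite natrD.
by case: i => [i|[i|i]] /=; rewrite ?(ord1 i) ?eqxx // => *; nra.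
Qed.

Lemma sum_complete s (i : 'I_s) (x : R) : \sum_(j | complete s i j) x = (s%:R - 1) * x.
Proof.
rewrite sum_nbrs_const; congr (_ * _).
have -> : degree (complete s) i = s.-1.
  rewrite -[s in RHS]card_ord -(cardC1 i); apply: eq_card => j.
  by rewrite !inE /= /complete_rel eq_sym.
by case: s i => [[]//|s] i /=; rewrite -[s.+1]addn1 natrD addrK.
Qed.

(** The entries are chosen so that the equations at [K_k] and [K_1] hold identically; the one at
    [K_m] is the cubic [lE]. *)
Lemma extremal_eigen i : \sum_(j | extremal i j) extremal_vec j = l * extremal_vec i.
Proof.
have const s (x : R) : \sum_(j < s) x = s%:R * x by rewrite sumr_const card_ord mulr_natl.
rewrite !big_sumType /=; case: i => [i|[i|i]] /=.
- by rewrite (sum_complete i) !const; lra.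
- rewrite const big_pred0 ?big_pred0 //; first by lra.
  by move=> j; rewrite /complete_rel (ord1 i) (ord1 j).
- rewrite const (sum_complete i) big_pred0 // add0r.
  by move: lE; lra.
Qed.

Lemma extremal_eigenvalue : eigenvalue (adjmx R extremal) l.
Proof.
apply/eigenvalue_eigenfun; exists extremal_vec; split; last exact: extremal_eigen.
have m0 : (0 < m)%N by apply: ltnW.
by exists (inr (inr (Ordinal m0))); rewrite gt_eqF // extremal_vec_gt0.
Qed.

(** By [subgraph_eigenfun], an edge [i j] of [extremal] lies in [G] once [f j != 0] and the entry of
    [extremal_vec] at [i] is positive; one end of the edge differs from [c] and can serve as [j]. *)
Lemma extremal_subgraph_eigenvalue (G : sgraph V) (l' : R) :
  subrel G extremal -> eigenvalue (adjmx R G) l' -> l <= l' -> G =2 extremal.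
Proof.
move=> GH /eigenvalue_eigenfun[f [[i0 fi0] Gf]] ll'.
have l'0 : 0 < l'.
  by have := m_ge2; have := k_ge0; have := l_ge; rewrite natrD; lra.
have eqz := subgraph_eigenfun GH extremal_vec_ge0 extremal_eigen (ltW l'0) ll' Gf.
(* A zero of [f] at [j != c] spreads to the whole clique avoiding [c], and then to [c] by the
   eigenvalue equation there, as [l' > 0]. *)
have f_neq0 j : j != c -> f j != 0.
  move=> jc; apply/negP=> /eqP fj; case/negP: fi0; apply/eqP.
  have [sumj _] := eqz j (extremal_vec_gt0 jc).
  have f0 i : i != c -> f i = 0.
    move=> ic; have [->//|ij] := eqVneq i j.
    apply/eqP/normr0P; rewrite fj normr0 mulr0 in sumj.
    apply: (psumr_eq0P _ sumj) => //; apply: extremal_clique => //.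
    by rewrite eq_sym.
  have [->|/f0->//] := eqVneq i0 c.
  have := Gf c; rewrite big1 => [|j' Gcj].
    by move/esym/eqP; rewrite mulf_eq0 gt_eqF //= => /eqP.
  by apply: f0; apply: contraTneq Gcj => ->; rewrite adj_irrefl.
(* At [c] the entry is [m * k], positive because a neighbour of [c] forces [k >= 1]. *)
have z_gt0 i j : extremal i j -> j != c -> 0 < extremal_vec i.
  move=> Hij jc; have [ic|] := eqVneq i c; last exact: extremal_vec_gt0.
  move: Hij jc; rewrite ic; case: j => [j|[j|j]] //= _; last by rewrite (ord1 j) eqxx.
  move=> _; have : (1 : R) <= k%:R by rewrite ler1n (leq_ltn_trans _ (ltn_ord j)).
  by have := m_ge2; nra.
move=> i j; apply/idP/idP => [/GH//|Hij].
have [jc|jc] := eqVneq j c; last by apply: (eqz i (z_gt0 _ _ Hij jc)).2 => //; apply: f_neq0.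
have ic : i != c by apply: contraTneq Hij => ->; rewrite jc adj_irrefl.
rewrite adj_sym; rewrite adj_sym in Hij.
by apply: (eqz j (z_gt0 _ _ Hij ic)).2 => //; apply: f_neq0.
Qed.

End Extremal.

(** * Graphs with a low-degree vertex inside the extremal graph *)

Section Relabel.
Variables (T1 T2 : finType) (G : sgraph T1) (g : T2 -> T1).

Definition relabel_rel : rel T2 := fun x y => G (g x) (g y).

Fact relabel_sym : symmetric relabel_rel.
Proof. by move=> x y; rewrite /relabel_rel adj_sym. Qed.

Fact relabel_irrefl : irreflexive relabel_rel.
Proof. by move=> x; rewrite /relabel_rel adj_irrefl. Qed.

Definition relabel := SGraph relabel_sym relabel_irrefl.

Lemma eigenvalue_relabel (R : realType) (l : R) : bijective g ->
  eigenvalue (adjmx R G) l -> eigenvalue (adjmx R relabel) l.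
Proof.
move=> gbij /eigenvalue_eigenfun[f [[i fi] Gf]]; apply/eigenvalue_eigenfun.
have [h gK hK] := gbij.
exists (f \o g); split=> [|x]; first by exists (h i); rewrite /= hK.
by rewrite /= -Gf [RHS](reindex g) //; apply: onW_bij.
Qed.

End Relabel.

Lemma card_between (T : finType) (A B : {set T}) (k : nat) :
  A \subset B -> (#|A| <= k <= #|B|)%N ->
  exists C : {set T}, [/\ A \subset C, C \subset B & #|C| = k].
Proof.
move=> AB /andP[Ak kB].
have /card_geqP[s [us ss sD]] : (k - #|A| <= #|B :\: A|)%N.
  by rewrite cardsD (finset.setIidPr AB) leq_sub2r.
exists (A :|: [set x in s]); split; first exact: finset.subsetUl.
  rewrite finset.subUset AB; apply/fintype.subsetP=> x; rewrite inE => /sD.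
  by rewrite inE => /andP[].
have -> : k = (#|A| + size s)%N by rewrite ss subnKC.
rewrite cardsU cardsE (card_uniqP us).
suff -> : A :&: [set x in s] = finset.set0 by rewrite cards0 subn0.
by apply/setP=> x; rewrite !inE; apply/negP=> /andP[xA /sD]; rewrite inE xA.
Qed.

(** [K_1] is sent to [v] and [K_k] onto a set of [k] vertices containing all neighbours of [v]. The
    only pairs not adjacent in [extremal] join [K_1] to [K_m], and [G] has no edge there. *)
Lemma extremal_embedding (T : finType) (G : sgraph T) (v : T) (k m : nat) :
  #|T| = (k + m).+1 -> (degree G v <= k)%N ->
  exists2 g : 'I_k + ('I_1 + 'I_m) -> T, bijective g &
    subrel (relabel G g) (extremal k m).
Proof.
move=> cT dv.
have [||A [NA Av cA]] := @card_between T [set u | G v u] (~: [set v]) k.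
- by apply/fintype.subsetP=> u; rewrite !inE; apply: contraTneq => ->; rewrite adj_irrefl.
- by rewrite dv cardsC1 cT leq_addr.
have vA : v \notin A by apply/negP=> /(fintype.subsetP Av); rewrite !inE eqxx.
pose B := ~: (v |: A).
have cB : #|B| = m by rewrite cardsCs finset.setCK cardsU1 vA cA cT; lia.
(* The default [v] of [nth] is never reached: the indices are below the cardinals of [A] and [B]. *)
pose g (x : 'I_k + ('I_1 + 'I_m)) := match x with
  | inl i => nth v (enum A) i
  | inr (inl _) => v
  | inr (inr i) => nth v (enum B) i end.
have gA (i : 'I_k) : nth v (enum A) i \in A.
  by rewrite -mem_enum mem_nth // -cardE cA.
have gB (i : 'I_m) : nth v (enum B) i \in B.
  by rewrite -mem_enum mem_nth // -cardE cB.
have AB u : u \in A -> u \in B -> False by rewrite !inE => ->; rewrite orbT.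
have vB : v \notin B by rewrite !inE eqxx.
have g_inj : injective g.
  move=> [i|[i|i]] [j|[j|j]] /=.
  - move/eqP; rewrite nth_uniq ?enum_uniq -?cardE ?cA // => /eqP/val_inj-> //.
  - by move=> E; case/negP: vA; rewrite -E.
  - by move=> E; case: (AB _ (gA i)); rewrite E.
  - by move=> E; case/negP: vA; rewrite E.
  - by rewrite (ord1 i) (ord1 j).
  - by move=> E; case/negP: vB; rewrite E.
  - by move=> E; case: (AB _ (gA j)); rewrite -E.
  - by move=> E; case/negP: vB; rewrite -E.
  - move/eqP; rewrite nth_uniq ?enum_uniq -?cardE ?cB // => /eqP/val_inj-> //.
exists g; first by apply: inj_card_bij => //; rewrite !card_sum !card_ord cT; lia.
have noB (i : 'I_m) : G v (nth v (enum B) i) -> False.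
  by move=> Gvi; apply: (AB _ _ (gB i)); apply: (fintype.subsetP NA); rewrite inE.
move=> x y; rewrite /= /relabel_rel => Gxy.
have xy : x != y by apply: contraTneq Gxy => ->; rewrite adj_irrefl.
move: x y xy Gxy => [i|[i|i]] [j|[j|j]] //=.
- by move=> _ /noB.
- by move=> _; rewrite adj_sym => /noB.
Qed.

(** * The degree condition and the conclusion *)

(** Let [n = #|T|]. The degrees of the complement sum to at most [2 * (n - 1)], so those at [v],
    [x], [y] sum to at most [n + 2]. The one at [v] is the largest of the three, so those at [x] and
    [y] sum to at most two thirds of [n + 2], which rounded down is at most [n - 2 * a]. *)
Lemma degree_pair_bound (T : finType) (G : sgraph T) (a : nat) (v x y : T) :
  (0 < a)%N -> ((2 * a + 2) * (a + 1) <= #|T|)%N ->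
  ((#|T| - 1) * (#|T| - 2) <= \sum_u degree G u)%N ->
  (forall u, degree G v <= degree G u)%N -> x != y -> x != v -> y != v ->
  (#|T| + 2 * a <= degree G x + degree G y + 2)%N.
Proof.
move=> a0 nlb sumG vmin xy xv yv.
have vx : v != x by rewrite eq_sym.
have vy : v != y by rewrite eq_sym.
have := degree_three (compl G) vx vy xy.
have : (\sum_u degree (compl G) u + \sum_u degree G u = #|T| * (#|T| - 1))%N.
  rewrite -big_split /= -sum_nat_const; apply: eq_bigr => u _.
  exact: degree_compl.
have := degree_compl G x; have := degree_compl G y; have := degree_compl G v.
move: (vmin x) (vmin y) sumG nlb.
move: (\sum_u degree (compl G) u)%N (\sum_u degree G u)%N => S1 S2.
move: (degree (compl G) x) (degree (compl G) y) (degree (compl G) v).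
move: (degree G x) (degree G y) (degree G v) #|T| => dx dy dv n cx cy cv.
move: a0; clear => a0 h1 h2 h3 h4 e1 e2 e3 e4 h5.
have h6 : (S1 <= 2 * (n - 1))%N by nia.
(* The difference of [2 * (a + 1) ^ 2] and [6 * a + 2] is [2 * a * (a - 1)]. *)
have h7 : (6 * a + 2 <= n)%N by nia.
lia.
Qed.

Theorem theorem1p5 (R : realType) (a b n : nat) (T : finType) (G : sgraph T)
    (ha : (0 < a)%N) (hb : (0 < b)%N) (hn : (0 < n)%N)
    (hab : (a <= b)%N) (hpar : (a = b %[mod 2])%N) (hna : ~~ odd (n * a)%N)
    (hG : #|T| = n)
    (hnlb : (maxn (2 * a * (a + 1) + b - 3) ((2 * a + 2) * (a + 1)) <= n)%N)
    (hrho : (spectral_radius R (Hgraph n a) <= spectral_radius R G)%R) :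
  ~ isomorphic G (Hgraph n a) -> has_parity_factor a b G.
Proof.
move=> notH.
have nlb : ((2 * a + 2) * (a + 1) <= n)%N.
  by apply: leq_trans hnlb; apply: leq_maxr.
have n8 : (8 <= n)%N by move: nlb ha; clear; nia.
have [k ka] : exists k, k = (a - 1)%N by eexists.
have [m ma] : exists m, m = (n - a)%N by eexists.
have nE : n = (k + m).+1 by move: nlb ha ka ma; clear; nia.
have m2 : (1 < m)%N by move: nlb ha ka ma; clear; nia.
have HE : Hgraph n a = extremal (a - 1) (n - a) by [].
move: notH hrho; rewrite HE -ka -ma => notH hrho.
have [l l_ge lE] := @extremal_cubic_root R k m (ltnW m2).
have lH := spectral_radius_ge (extremal_eigenvalue m2 l_ge lE).
have n2 : (n - 2)%:R <= l.
  have kmE : (k + m = (n - 2) + 1)%N by move: nE n8; clear; lia.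
  by move: l_ge; rewrite kmE natrD addrK.
have n2_gt0 : 0 < (n - 2)%:R :> R by rewrite ltr0n; move: n8; clear; lia.
have [l' El' ll'] := spectral_radius_attained (lt_le_trans n2_gt0 n2) (le_trans lH hrho).
have [v0 _] : exists v : T, v \in T by apply/card_gt0P; rewrite hG.
have [v _ vmin] := arg_minnP (degree G) (erefl (xpredT v0)).
have dv : (a <= degree G v)%N.
  (* A vertex of degree below [a] places [G] inside a copy of [extremal k m], where the eigenvalue
     [l' >= l] forces equality. *)
  rewrite leqNgt; apply/negP=> dv; apply: notH.
  have [||g gbij sub] := @extremal_embedding T G v k m.
  - by rewrite hG.
  - by rewrite ka; move: dv; clear; lia.
  have GE := extremal_subgraph_eigenvalue m2 l_ge lE sub (eigenvalue_relabel gbij El') ll'.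
  have [h gK hK] := gbij; exists h; first by exists g.
  by move=> u w; rewrite -GE /= /relabel_rel !hK.
(* Stanley's bound at [l' >= n - 2]. *)
have sumG : ((n - 1) * (n - 2) <= \sum_u degree G u)%N.
  rewrite -(ler_nat R); apply: le_trans (eigenvalue_degree_sum El').
  have -> : (n - 1 = (n - 2) + 1)%N by move: n8; clear; lia.
  by rewrite natrM natrD; have := le_trans n2 ll'; nra.
have [F FG Fa] : exists2 F : sgraph T, subrel F G & forall u, degree F u = a.
  apply: (@regular_factor T G a v); rewrite ?hG //; first by move: n8; clear; lia.
  by rewrite -hG; move=> x y; apply: degree_pair_bound; rewrite ?hG // => u; apply: vmin.
by exists F; split=> // u; rewrite Fa leqnn.
Qed.
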